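(* Let $L$ be a nilpotent symplectic alternating algebra of dimension $2n\geq 2$. There exists an ascending chain of isotropic ideals $$\{0\}=I_0<I_1<\cdots<I_{n-1}<I_n$$ such that $\dim I_r=r$ for $r=0,\ldots,n$. Furthermore, for $2n\geq 6$, $I_{n-1}^{\perp}$ is abelian and the ascending chain $$\{0\}<I_2<I_3<\cdots<I_{n-1}<I_{n-1}^{\perp}<I_{n-2}^{\perp}<\cdots<I_2^{\perp}<L$$ is a central chain. In particular (for $2n\geq 6$) $L$ is nilpotent of class at most $2n-3$.
   Context: A symplectic alternating algebra (SAA) over a field $\mathbb{F}$ is a finite-dimensional vector space $L$ over $\mathbb{F}$ with a non-degenerate alternating bilinear form $(\ ,\ )$ and a bilinear product $\cdot$ satisfying $u\cdot u=0$ for all $u$ and $(u\cdot v,w)=(v\cdot w,u)$ for all $u,v,w\in L$. No associativity or Jacobi identity is assumed. For subspaces $U,V$, $UV$ is the subspace spanned by all products $uv$, $u\in U$, $v\in V$. A subspace $I$ is an ideal if $IL\leq I$; it is abelian if $II=\{0\}$; it is isotropic if $(u,v)=0$ for all $u,v\in I$. $I^{\perp}$ is the orthogonal complement of $I$ with respect to $(\ ,\ )$. A chain of ideals $J_0\leq J_1\leq\cdots\leq J_m$ is central if $J_sL\leq J_{s-1}$ for $s=1,\ldots,m$. $L^1=L$, $L^{m+1}=L^mL$; $L$ is nilpotent if $L^{m+1}=\{0\}$ for some $m\geq 0$, and the smallest such $m$ is its (nilpotence) class. *)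

(* Defs.v *)
From HB Require Import structures.
From mathcomp Require Import all_boot all_order all_algebra.

Set Implicit Arguments.
Unset Strict Implicit.
Unset Printing Implicit Defensive.

Import GRing.Theory.
Local Open Scope ring_scope.

(* The type {skew_symmetric L} (bilinear forms with (u, v) = - (v, u)) is
   what the library's [orthov] and [nondegenerate] are defined on. It adds
   nothing to bilinearity and [saa_form_alt], which imply skew-symmetry. In
   characteristic 2, [saa_form_alt] is not implied by skew-symmetry. *)
Record saa (F : fieldType) (L : vectType F) := SAA {
  saa_form : {skew_symmetric L};
  saa_mul : {bilinear L -> L -> L};
  saa_form_alt : forall u : L, saa_form u u = 0;
  saa_form_nondeg : nondegenerate saa_form;
  saa_mul_alt : forall u : L, saa_mul u u = 0;
  saa_cyclic : forall u v w : L,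
    saa_form (saa_mul u v) w = saa_form (saa_mul v w) u
}.

Definition ltv (F : fieldType) (L : vectType F) (U V : {vspace L}) : bool :=
  (U <= V)%VS && (U != V).

Section SAATheory.
Variables (F : fieldType) (L : vectType F) (A : saa L).
Implicit Types (U V W I : {vspace L}) (u v : L).

(* Same pattern as [prodv] in falgebra, which requires an associative unital
   product; products of basis vectors suffice by bilinearity, see [smulP]. *)
Definition smul U V : {vspace L} :=
  <<[seq saa_mul A u v | u <- vbasis U, v <- vbasis V]>>%VS.

Definition perp V : {vspace L} := orthov (saa_form A) V.

Definition ideal I : Prop := (smul I fullv <= I)%VS.

Definition abelian_ideal I : Prop := ideal I /\ smul I I = 0%VS.

Definition isotropic_ideal I : Prop :=
  ideal I /\ {in I &, forall u v, saa_form A u v = 0}.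

Definition central_chain (J : seq {vspace L}) : Prop :=
  [/\ {in J, forall I, ideal I},
      sorted (fun U V => (U <= V)%VS) J &
      forall s, (1 <= s < size J)%N ->
        (smul (nth 0%VS J s) fullv <= nth 0%VS J s.-1)%VS].

(* [lpow m] is L^m for m >= 1; the value at m = 0 is a dummy. *)
Definition lpow (m : nat) : {vspace L} :=
  iter m.-1 (fun U => smul U fullv) fullv.

Definition nilpotent : Prop := exists m, lpow m.+1 == 0%VS.

Definition nilclass (hA : nilpotent) : nat := ex_minn hA.

Lemma mem_smul U V u v : u \in U -> v \in V -> saa_mul A u v \in smul U V.
Proof.
move=> /coord_vbasis -> /coord_vbasis ->.
rewrite linear_sumlz; apply: memv_suml => i _.
rewrite linear_sumr; apply: memv_suml => j _.
rewrite linearZl_LR linearZr_LR !memvZ //.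
apply/memv_span/allpairs_f; apply: mem_nth; rewrite size_tuple; exact: ltn_ord.
Qed.

Lemma smulP U V W :
  reflect {in U & V, forall u v, saa_mul A u v \in W} (smul U V <= W)%VS.
Proof.
apply: (iffP idP) => [/subvP sUVW u v Uu Vv | sUVW].
  by apply/sUVW/mem_smul.
apply/span_subvP=> _ /allpairsP[[u v] /= [Uu Vv ->]].
by apply: sUVW; apply: vbasis_mem.
Qed.

Lemma mem_perp V u :
  reflect {in V, forall v, saa_form A u v = 0} (u \in perp V).
Proof. exact: mem_orthovP. Qed.

Lemma nondegP :
  reflect (forall u, (forall v, saa_form A u v = 0) -> u = 0)
          (nondegenerate (saa_form A)).
Proof.
apply: (iffP eqP) => [rad0 u u0 | rad0].
  by apply/eqP; rewrite -memv0 -rad0; apply/mem_orthovP=> v _; apply: u0.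
apply/eqP; rewrite -subv0; apply/subvP=> u /mem_orthovP u0.
by rewrite memv0; apply/eqP/rad0=> v; apply/u0/memvf.
Qed.

End SAATheory.

(* {0}, I_2, ..., I_{n-1}, I_{n-1}^perp, ..., I_2^perp, L *)
Definition perp_chain (F : fieldType) (L : vectType F) (A : saa L) (n : nat)
    (I : nat -> {vspace L}) : seq {vspace L} :=
  0%VS :: [seq I r | r <- index_iota 2 n]
       ++ [seq perp A (I r) | r <- rev (index_iota 2 n)]
       ++ [:: fullv].

(* Main.v *)
Require Import Defs.
From HB Require Import structures.
From mathcomp Require Import all_boot all_order all_algebra.
From mathcomp Require Import zify.
Import GRing.Theory.
Local Open Scope ring_scope.

(** Right multiplications are self-adjoint for the form, (ux, v) = (u, vx), so
    orthogonal complements reverse inclusions V L <= U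
    ([smul_full_perp]): V L <= U implies U^perp L <= V^perp. In particular
    the complement of an ideal is an ideal.

    If I is an isotropic ideal of dimension below n, then I^perp is a strictly
    larger ideal. By nilpotency some a in I^perp, outside I, satisfies
    a L <= I ([nilpotent_step]), and I + <a> is again an isotropic ideal.
    Iterating yields a flag I_0 < ... < I_n with I_r L <= I_{r-1}, and any such
    flag with I_n isotropic has the remaining properties when n >= 3:

    - The complements satisfy I_{r-1}^perp L <= I_r^perp, by duality.
    - I_2 L = 0, as I_2 L lies in the line I_1 ([smul_into_line_eq0]); dually
      L L <= I_2^perp.
    - K = I_{n-1}^perp contains I_n = I_n^perp with codimension one, and
      K L <= I_n by duality. This makes K abelian
      ([abelian_of_central_over_lagrangian]), and then K L <= K^perp = I_{n-1}
      by cyclicity of the form ([abelian_smul_perp]).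

    The central chain obtained has 2n - 2 members, which bounds the class by
    2n - 3. *)

Section SymplecticAlternatingAlgebra.
Variables (F : fieldType) (L : vectType F) (A : saa L).
Implicit Types (U V W X : {vspace L}) (u v w x : L) (I : nat -> {vspace L}).

Local Notation "u '·' v" := (saa_mul A u v) (at level 40, left associativity).
Local Notation "'⟨' u , v '⟩'" := (saa_form A u v) (at level 0).
Local Notation "V ^⊥" := (perp A V) (at level 2, format "V ^⊥").

(** * Orthogonal complements *)

Lemma perp_sym U V : (U <= V^⊥)%VS = (V <= U^⊥)%VS.
Proof. exact: orthov_sym. Qed.

Lemma perpD U V : (U + V)%VS^⊥ = (U^⊥ :&: V^⊥)%VS.
Proof.
apply: subv_anti; rewrite subv_cap ![(_^⊥ <= _^⊥)%VS]perp_sym.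
rewrite -[(U <= _)%VS]perp_sym -[(V <= _)%VS]perp_sym /perp -orthovD subvv /=.
by rewrite orthovD capvSl capvSr.
Qed.

(** Each vector of s imposes at most one independent linear condition on X. *)
Lemma dim_cap_perp_span X (s : seq L) :
  (\dim X <= \dim (X :&: <<s>>%VS^⊥) + size s)%N.
Proof.
elim: s X => [|a s IHs] X.
  by rewrite span_nil /perp orthov0 capvf addn0.
rewrite span_cons perpD capvA /= addnS.
have := leq_dim_orthov1 (saa_form A) a X.
have := IHs (X :&: <[a]>^⊥)%VS.
rewrite /perp; move: (\dim _) (\dim _) (\dim _) => p q r; lia.
Qed.

(** The sum on the left can only grow with V, since enlarging V by k dimensions
    imposes at most k further conditions; by non-degeneracy it has the same
    value at V = 0 and at V = L, so it is constant. *)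
Lemma dim_perp V : (\dim V + \dim V^⊥)%N = \dim {:L}.
Proof.
have mono U W : (U <= W)%VS ->
    (\dim U + \dim U^⊥ <= \dim W + \dim W^⊥)%N.
  move=> sUW; have := dim_cap_perp_span U^⊥ (vbasis (W :\: U)).
  rewrite size_tuple (span_basis (vbasisP _)) -perpD.
  have -> : (U + (W :\: U) = W)%VS by rewrite addvC addv_diff; apply/addv_idPl.
  have := dimv_cap_compl W U; rewrite (capv_idPr sUW).
  move: (\dim _) (\dim _) (\dim _) (\dim _) (\dim _) => p q r s t; lia.
apply/eqP; rewrite eqn_leq.
have := mono _ _ (sub0v V); rewrite dimv0 /perp orthov0 => ->.
have := mono _ _ (subvf V); rewrite /perp.
by rewrite (eqP (saa_form_nondeg A)) dimv0 addn0 => ->.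
Qed.

Lemma perpK V : V^⊥^⊥ = V.
Proof.
apply/esym/eqP; rewrite eqEdim perp_sym subvv /=.
by have := dim_perp V; have := dim_perp V^⊥; lia.
Qed.

(** * Self-adjointness of multiplication *)

Lemma saa_formN u v : ⟨u, v⟩ = - ⟨v, u⟩.
Proof. by rewrite hermC /= expr1 mulN1r. Qed.

Lemma saa_mulN u v : u · v = - (v · u).
Proof.
apply/eqP; rewrite -addr_eq0; apply/eqP.
have := saa_mul_alt A (u + v).
by rewrite linearDl !linearDr !saa_mul_alt addr0 add0r.
Qed.

Lemma saa_mul_selfadjoint x u v : ⟨u · x, v⟩ = ⟨u, v · x⟩.
Proof. by rewrite saa_cyclic saa_mulN linearNl -saa_formN. Qed.

Lemma form_mulr u x : ⟨u · x, x⟩ = 0.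
Proof. by rewrite saa_cyclic saa_mul_alt linear0l. Qed.

(** The duality that turns an ascending central chain into a descending one:
    a consequence of self-adjointness of multiplication. *)
Lemma smul_full_perp U V :
  (smul A V fullv <= U)%VS -> (smul A U^⊥ fullv <= V^⊥)%VS.
Proof.
move=> /smulP VLU; apply/smulP=> u x /mem_perp Uu _.
by apply/mem_perp=> v Vv; rewrite saa_mul_selfadjoint; apply/Uu/VLU/memvf.
Qed.

Lemma smulS U V W : (U <= V)%VS -> (smul A U W <= smul A V W)%VS.
Proof. by move=> /subvP UV; apply/smulP=> u w /UV Vu Ww; apply: mem_smul. Qed.

Lemma smulDl U V W X :
  (smul A U W <= X)%VS -> (smul A V W <= X)%VS -> (smul A (U + V) W <= X)%VS.
Proof.
move=> /smulP UW /smulP VW; apply/smulP=> _ w /memv_addP[u Uu [v Vv ->]] Ww.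
by rewrite linearDl; apply: memvD; [apply: UW | apply: VW].
Qed.

Lemma dim_add_line U a : a \notin U -> \dim (U + <[a]>) = (\dim U).+1.
Proof.
move=> nUa; have /dimv_disjoint_sum-> : (U :&: <[a]> = 0)%VS.
  apply/eqP; rewrite -subv0; apply/subvP=> v /memv_capP[Uv /vlineP[k def_v]].
  move: Uv; rewrite memv0 def_v.
  have [-> | k0] := eqVneq k 0; first by rewrite scale0r.
  by rewrite rpredZeq (negPf k0) (negPf nUa).
rewrite dim_vline; case: eqVneq nUa => [-> | _ _]; first by rewrite mem0v.
by rewrite addn1.
Qed.

(** * Nilpotency *)

(** The ideals V, VL, (VL)L, ... decrease inside V and reach 0, so there is a
    last one that is not contained in U; all its elements are sent into U by L,
    and one of them is outside U. *)
Lemma nilpotent_step U V : nilpotent A -> ideal A V -> ~~ (V <= U)%VS ->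
  exists a, [/\ a \in V, a \notin U & (smul A <[a]> fullv <= U)%VS].
Proof.
move=> [m /eqP Lm0] idV nVU.
pose D k := iter k (fun W => smul A W fullv) V.
have DV k : (D k <= V)%VS.
  by elim: k => // k IHk; apply: subv_trans idV; apply: smulS.
have DL k : (D k <= lpow A k.+1)%VS.
  by elim: k => [|k]; [apply: subvf | apply: smulS].
have exk : exists k, (D k <= U)%VS.
  by exists m; apply: subv_trans (DL m) _; rewrite Lm0 sub0v.
case: (ex_minnP exk) => -[|k] DkU min_k; first by rewrite DkU in nVU.
have /subvPn[a Da nUa] : ~~ (D k <= U)%VS.
  by apply/negP=> /min_k; rewrite ltnn.
exists a; split=> //; first exact: subvP (DV k) _ Da.
by apply: subv_trans DkU; apply: smulS; rewrite -memvE.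
Qed.

(** Descending from L, the lower central series goes down at least as fast as
    any central chain that ends at L. *)
Lemma lpow_central_chain (J : seq {vspace L}) k :
  central_chain A J -> last 0%VS J = fullv -> (k < size J)%N ->
  (lpow A k.+1 <= nth 0%VS J (size J - k.+1))%VS.
Proof.
move=> [_ _ cenJ] lastJ; elim: k => [|k IHk] ltkJ.
  by rewrite subn1 nth_last lastJ subvf.
apply: subv_trans (smulS _ _ _ (IHk (ltnW ltkJ))) _.
rewrite (subnS _ k.+1); apply: cenJ; lia.
Qed.

(** * Flags of isotropic ideals *)

(** The inclusions V L <= U between consecutive members are recorded rather than
    just the ideal property: they imply it, and they are what the duality
    transports to the complements. *)
Definition central_flag p I : Prop :=
  [/\ I 0%N = 0%VS,
      forall r, (r <= p)%N -> \dim (I r) = r,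
      forall r, (r < p)%N -> (I r <= I r.+1)%VS &
      forall r, (r < p)%N -> (smul A (I r.+1) fullv <= I r)%VS].

Lemma central_flag_sub p I r s :
  central_flag p I -> (r <= s <= p)%N -> (I r <= I s)%VS.
Proof.
move=> [_ _ subI _] /andP[]; elim: s => [|s IHs]; first by case: r.
rewrite leq_eqVlt => /predU1P[-> // | lers ltsp].
exact: subv_trans (IHs lers (ltnW ltsp)) (subI s ltsp).
Qed.

Lemma central_flag_ideal p I r :
  central_flag p I -> (r <= p)%N -> ideal A (I r).
Proof.
move=> flagI; have [I0 _ subI cenI] := flagI.
case: r => [_ | r lerp].
  rewrite I0; apply/smulP=> u x; rewrite memv0 => /eqP-> _.
  by rewrite linear0l mem0v.
exact: subv_trans (cenI r lerp) (subI r lerp).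
Qed.

(** While I_p has dimension below n, its complement is strictly larger, so
    [nilpotent_step] applies to the pair I_p, I_p^perp; the vector it gives is
    orthogonal to I_p and to itself. *)
Lemma isotropic_central_flag_exists n p :
  nilpotent A -> \dim {:L} = (2 * n)%N -> (p <= n)%N ->
  exists I, central_flag p I /\ (I p <= (I p)^⊥)%VS.
Proof.
move=> nilA dimL; elim: p => [_ | p IHp ltpn].
  exists (fun=> 0%VS); split; last exact: sub0v.
  by split=> // r; rewrite leqn0 dimv0 => /eqP.
have [I [flagI isoI]] := IHp (ltnW ltpn).
have [I0 dimI subI cenI] := flagI.
have dI := dimI p (leqnn p).
have idU : ideal A (I p) by exact: central_flag_ideal flagI _.
have nVU : ~~ ((I p)^⊥ <= I p)%VS.
  by apply/negP=> /dimvS; have := dim_perp (I p); lia.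
have [a [Va nUa aL]] := nilpotent_step _ _ nilA (smul_full_perp _ _ idU) nVU.
pose W := (I p + <[a]>)%VS.
have dimW : \dim W = p.+1 by rewrite dim_add_line ?dI.
exists (fun r => if (r <= p)%N then I r else W); split; last first.
  have aIp : (I p <= <[a]>^⊥)%VS by rewrite perp_sym -memvE.
  have aa : (<[a]> <= <[a]>^⊥)%VS by rewrite /perp orthov11 saa_form_alt.
  by rewrite ltnn perpD subv_cap !subv_add isoI aIp aa -memvE Va.
split=> // r.
- rewrite leq_eqVlt ltnS => /predU1P[-> | lerp]; first by rewrite ltnn.
  by rewrite lerp dimI.
- rewrite ltnS; case: ltngtP => // [ltrp _ | -> _]; first exact: subI.
  exact: addvSl.
- rewrite ltnS; case: ltngtP => // [ltrp _ | -> _]; first exact: cenI.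
  exact: smulDl.
Qed.

(** Suppose u x <> 0 with u in V, so that ux spans U. For every y, uy = c ux
    and (uy, y) = 0, whence c = 0 unless (ux, y) = 0. But if c = 0 then
    (ux, y) = - (uy, x) = 0 as well. So ux is orthogonal to L, contradicting
    non-degeneracy. *)
Lemma smul_into_line_eq0 U V : \dim U = 1%N -> (smul A V fullv <= U)%VS ->
  smul A V fullv = 0%VS.
Proof.
move=> dU /smulP VLU; apply/eqP; rewrite -subv0; apply/smulP=> u x Vu _.
rewrite memv0; apply: contraT => ux0.
have Uux : u · x \in U by apply: VLU; rewrite ?memvf.
have defU : U = <[u · x]>%VS.
  by apply/esym/eqP; rewrite eqEdim -memvE Uux dU dim_vline ux0.
suff : u · x == 0 by rewrite (negPf ux0).
apply/eqP/(nondegP A (saa_form_nondeg A)) => y.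
have /vlineP[c def_uy] : u · y \in <[u · x]>%VS.
  by rewrite -defU; apply: VLU; rewrite ?memvf.
apply/eqP; apply: contraT => uxy.
have c0 : c = 0.
  have := form_mulr u y; rewrite def_uy linearZl_LR /= => /eqP.
  by rewrite mulf_eq0 (negPf uxy) orbF => /eqP.
by move: uxy; rewrite saa_cyclic saa_mulN linearNl /= -saa_cyclic def_uy c0
  scale0r linear0l oppr0 eqxx.
Qed.

(** For u in N and v in K, (uv, w) = (u, wv) = 0 because wv lies in N = N^perp;
    so N K = 0. As K is N plus at most one line <u>, and u u = 0, nothing is
    left of K K. *)
Lemma abelian_of_central_over_lagrangian N K :
  N^⊥ = N -> (N <= K)%VS -> (\dim K <= (\dim N).+1)%N ->
  (smul A K fullv <= N)%VS -> smul A K K = 0%VS.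
Proof.
move=> perpN sNK dK /smulP KL; apply/eqP; rewrite -subv0.
have NK0 u v : u \in N -> v \in K -> u · v = 0.
  move=> Nu Kv; apply: (nondegP A (saa_form_nondeg A)) => w.
  have /mem_perp uN : u \in N^⊥ by rewrite perpN.
  rewrite saa_mul_selfadjoint; apply: uN.
  by rewrite saa_mulN memvN; apply: KL; rewrite ?memvf.
apply/smulP=> u v Ku Kv; rewrite memv0; apply/eqP.
have [Nu | nNu] := boolP (u \in N); first exact: NK0.
have defK : K = (N + <[u]>)%VS.
  by apply/esym/eqP; rewrite eqEdim subv_add sNK -memvE Ku dim_add_line.
move: Kv; rewrite defK => /memv_addP[w Nw [_ /vlineP[k ->] ->]].
by rewrite linearDr linearZr_LR saa_mul_alt scaler0 addr0 saa_mulN NK0 ?oppr0.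
Qed.

(** By cyclicity (ux, v) = (vu, x). *)
Lemma abelian_smul_perp K : smul A K K = 0%VS -> (smul A K fullv <= K^⊥)%VS.
Proof.
move=> KK0; apply/smulP=> u x Ku _; apply/mem_perp=> v Kv.
have /eqP vu0 : v · u == 0 by rewrite -memv0 -KK0 mem_smul.
by rewrite saa_cyclic saa_cyclic vu0 linear0l.
Qed.

Lemma lagrangian_perp n N : \dim {:L} = (2 * n)%N -> \dim N = n ->
  (N <= N^⊥)%VS -> N^⊥ = N.
Proof.
move=> dimL dimN isoN; apply/esym/eqP; rewrite eqEdim isoN /=.
by have := dim_perp N; lia.
Qed.

Lemma central_flag_perp_abelian n I :
  \dim {:L} = (2 * n)%N -> (0 < n)%N -> central_flag n I ->
  (I n <= (I n)^⊥)%VS -> smul A (I n.-1)^⊥ (I n.-1)^⊥ = 0%VS.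
Proof.
move=> dimL; case: n dimL => // m dimL _ /= flagI isoI.
have [_ dimI subI cenI] := flagI.
have perpN := lagrangian_perp _ _ dimL (dimI _ (leqnn _)) isoI.
apply: (abelian_of_central_over_lagrangian (I m.+1)) => //.
- by rewrite -perpN perp_sym perpK subI.
- by have := dim_perp (I m); rewrite !dimI //; lia.
- by rewrite -perpN; apply: smul_full_perp; apply: cenI.
Qed.

(** * The central chain *)

Definition central_step U V : bool := ltv U V && (smul A V fullv <= U)%VS.

Lemma central_stepI U V : (U <= V)%VS -> (\dim U < \dim V)%N ->
  (smul A V fullv <= U)%VS -> central_step U V.
Proof.
move=> sUV ltUV VLU; rewrite /central_step /ltv sUV VLU andbT /=.
by apply: contraTneq ltUV => ->; rewrite ltnn.
Qed.

Lemma sorted_map_iota (e : rel {vspace L}) I m k :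
  (forall r, (m <= r)%N -> (r.+1 < m + k)%N -> e (I r) (I r.+1)) ->
  sorted e [seq I r | r <- iota m k].
Proof.
move=> eI; apply/(sortedP 0%VS) => i; rewrite size_map size_iota => lti.
by rewrite !(nth_map 0%N) ?size_iota ?nth_iota ?(ltnW lti) // addnS eI //; lia.
Qed.

(** The chain consists of an ascending half, the complements of that half in
    reverse order, and three junctions: 0 < I_2 (centrality of I_2),
    I_{n-1} < I_{n-1}^perp (commutativity of I_{n-1}^perp) and I_2^perp < L
    (the dual of the first). *)
Lemma perp_chain_central_step n I :
  \dim {:L} = (2 * n)%N -> (3 <= n)%N -> central_flag n I ->
  (I n <= (I n)^⊥)%VS -> path central_step 0%VS (behead (perp_chain A n I)).
Proof.
move=> dimL len flagI isoI; have [I0 dimI subI cenI] := flagI.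
have KK0 := central_flag_perp_abelian _ _ dimL (ltnW (ltnW len)) flagI isoI.
have I2L : smul A (I 2) fullv = 0%VS.
  by apply: (smul_into_line_eq0 (I 1)); [apply: dimI | apply: cenI]; lia.
have dimP r : (r <= n)%N -> \dim (I r)^⊥ = (2 * n - r)%N.
  by move=> lern; have := dim_perp (I r); rewrite dimI //; lia.
have isoI' : (I n.-1 <= (I n.-1)^⊥)%VS.
  have sI : (I n.-1 <= I n)%VS by apply: central_flag_sub flagI _; lia.
  apply: subv_trans (subv_trans sI isoI) _.
  by rewrite perp_sym perpK.
rewrite /perp_chain /index_iota /=.
(* Written as a successor, the length exposes both ends of each half. *)
have -> : (n - 2 = (n - 3).+1)%N by lia.
have last1 : last 0%VS [seq I r | r <- iota 2 (n - 3).+1] = I n.-1.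
  by rewrite -[(n - 3).+1]addn1 iotaD map_cat last_cat /=; congr I; lia.
have def2 : [seq (I r)^⊥ | r <- rev (iota 2 (n - 3).+1)] =
            rev [seq (I r)^⊥ | r <- iota 2 (n - 3).+1] by rewrite map_rev.
rewrite cat_path last1 cat_path; apply/and3P; split.
- rewrite /= central_stepI ?sub0v ?I2L ?dimv0 ?dimI ?(ltnW len) //=.
  apply: (sorted_map_iota _ I 2 (n - 3).+1) => r _ ltr.
  by apply: central_stepI; rewrite ?dimI ?subI ?cenI //; lia.
- have : sorted central_step [seq (I r)^⊥ | r <- rev (iota 2 (n - 3).+1)].
    rewrite def2 rev_sorted.
    apply: (sorted_map_iota _ (fun r => (I r)^⊥)) => r _ ltr.
    apply: central_stepI; rewrite ?dimP; try lia.
      by rewrite perp_sym perpK subI //; lia.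
    by apply: smul_full_perp; apply: cenI; lia.
  rewrite -[(n - 3).+1]addn1 iotaD rev_cat /= => ->; rewrite andbT.
  have -> : (2 + (n - 3) = n.-1)%N by lia.
  apply: central_stepI; rewrite ?dimP ?dimI //; try lia.
  by rewrite -{2}[I n.-1]perpK abelian_smul_perp.
- rewrite def2 /= rev_cons last_rcons andbT.
  apply: central_stepI; rewrite ?subvf ?dimP ?dimL //; try lia.
  by have := smul_full_perp 0%VS (I 2); rewrite I2L {1}/perp orthov0; apply.
Qed.

Lemma sorted_central_chain (J : seq {vspace L}) :
  sorted central_step (0%VS :: J) -> central_chain A (0%VS :: J).
Proof.
move=> sJ; have step s : (1 <= s < size (0%VS :: J))%N ->
    central_step (nth 0%VS (0%VS :: J) s.-1) (nth 0%VS (0%VS :: J) s).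
  by case: s => // s /andP[_ lts]; apply: (sortedP 0%VS sJ).
split.
- move=> V /(nthP 0%VS)[[_ <- | s lts <-]].
    apply/smulP=> u x; rewrite memv0 => /eqP-> _.
    by rewrite linear0l mem0v.
  have /andP[/andP[sUV _] cen] := step s.+1 lts.
  exact: subv_trans cen sUV.
- by apply: sub_sorted sJ => U V /andP[/andP[]].
- by move=> s /step/andP[].
Qed.

End SymplecticAlternatingAlgebra.

Theorem theorem3p20 (F : fieldType) (L : vectType F) (A : saa L) (n : nat)
    (hn : (2 <= 2 * n)%N) (hdim : \dim {:L} = (2 * n)%N) (hnil : nilpotent A) :
  (exists I : nat -> {vspace L},
     [/\ I 0%N = 0%VS,
         (forall r, (r < n)%N -> ltv (I r) (I r.+1)),
         (forall r, (r <= n)%N -> isotropic_ideal A (I r)) &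
         (forall r, (r <= n)%N -> \dim (I r) = r)] /\
     ((6 <= 2 * n)%N ->
        [/\ abelian_ideal A (perp A (I n.-1)),
            sorted (@ltv F L) (perp_chain A n I) &
            central_chain A (perp_chain A n I)])) /\
  ((6 <= 2 * n)%N -> (nilclass hnil <= 2 * n - 3)%N).
Proof.
have n0 : (0 < n)%N by lia.
have [I [flagI isoI]] :=
  isotropic_central_flag_exists _ _ A n n hnil hdim (leqnn n).
have [I0 dimI subI cenI] := flagI.
have chain : (6 <= 2 * n)%N -> sorted (central_step _ _ A) (perp_chain A n I).
  by move=> n3; apply: perp_chain_central_step => //; lia.
split; last first.
  move=> n3; rewrite /nilclass; case: ex_minnP => m _; apply.
  have cen := sorted_central_chain _ _ _ _ (chain n3).
  have sz : size (perp_chain A n I) = (2 * n - 2)%N.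
    by rewrite /= !size_cat !size_map size_rev size_iota /=; lia.
  have := lpow_central_chain _ _ _ _ (2 * n - 3) cen.
  rewrite sz; have -> : (2 * n - 2 - (2 * n - 3).+1 = 0)%N by lia.
  rewrite -subv0; apply; last by lia.
  by rewrite /perp_chain /= !last_cat.
exists I; split.
  split=> // r ler.
  - rewrite /ltv subI //=; apply/eqP=> /(congr1 (fun U => \dim U)).
    by rewrite !dimI //; lia.
  - split; first exact: central_flag_ideal flagI ler.
    have sI : (I r <= I n)%VS.
      by apply: central_flag_sub flagI _; rewrite ler leqnn.
    move=> u v /(subvP sI) Iu /(subvP sI) Iv.
    by have /mem_perp-> := subvP isoI _ Iu.
move=> n3; split.
- split; last exact: central_flag_perp_abelian.
  by apply: smul_full_perp; apply: central_flag_ideal flagI _; lia.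
- by apply: sub_sorted (chain n3) => U V /andP[].
- exact: sorted_central_chain (chain n3).
Qed.
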